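(* There is a translation $\mathscr{T}_{\mathsf{c}}$ of formulas and proofs that assigns, to every proof $p$ of a sequent $\Delta \vdash \Gamma$ in LK$^-$, a proof $\mathscr{T}_{\mathsf{c}}(p)$ of the sequent $! \mathscr{T}_{\mathsf{c}}^\ast(\Delta) \vdash ? \mathscr{T}_{\mathsf{c}}^\ast(\Gamma)$ in LLK$^-$, where $\mathscr{T}_{\mathsf{c}}(\top) = \top$, $\mathscr{T}_{\mathsf{c}}(\bot) = \bot$, $\mathscr{T}_{\mathsf{c}}(A \wedge B) = ? \mathscr{T}_{\mathsf{c}}(A) \,\&\, ? \mathscr{T}_{\mathsf{c}}(B)$, $\mathscr{T}_{\mathsf{c}}(A \vee B) = ! \mathscr{T}_{\mathsf{c}}(A) \oplus ! \mathscr{T}_{\mathsf{c}}(B)$ and $\mathscr{T}_{\mathsf{c}}(A \Rightarrow B) = ! ? \mathscr{T}_{\mathsf{c}}(A) \multimap ? ! \mathscr{T}_{\mathsf{c}}(B)$.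
   Context: Propositional logic. Notation: $!$ is the exponential ''of course'', $?$ is ''why not'', $⅋$ is par; for $f \in \{!, ?\}$, $f(A_1, \dots, A_k) = fA_1, \dots, fA_k$, and $\mathscr{T}_{\mathsf{c}}^\ast$ applies $\mathscr{T}_{\mathsf{c}}$ to each formula of a sequence. LK$^-$ is the sequent calculus for classical logic with constants $\top,\bot$ and connectives $\wedge,\vee,\Rightarrow$ (negation defined by $\neg A = A \Rightarrow \bot$) with rules: Id ($A \vdash A$); Cut (from $\Delta \vdash B, \Gamma$ and $\Delta', B \vdash \Gamma'$ infer $\Delta, \Delta' \vdash \Gamma, \Gamma'$); exchange XL, XR; weakening WL, WR; contraction CL, CR; $\top$L (from $\Delta \vdash \Gamma$ infer $\Delta, \top \vdash \Gamma$); $\top$R ($\vdash \top$); $\bot$L ($\bot \vdash$); $\bot$R (from $\Delta \vdash \Gamma$ infer $\Delta \vdash \bot, \Gamma$); $\wedge$L (from $\Delta, A_1, A_2 \vdash \Gamma$ infer $\Delta, A_1 \wedge A_2 \vdash \Gamma$); $\wedge$R (from $\Delta \vdash B_1, \Gamma$ and $\Delta \vdash B_2, \Gamma$ infer $\Delta \vdash B_1 \wedge B_2, \Gamma$); $\vee$L (from $\Delta, A_1 \vdash \Gamma$ and $\Delta, A_2 \vdash \Gamma$ infer $\Delta, A_1 \vee A_2 \vdash \Gamma$); $\vee$R (from $\Delta \vdash B_1, B_2, \Gamma$ infer $\Delta \vdash B_1 \vee B_2, \Gamma$); $\Rightarrow$L (from $\Delta \vdash A, \Gamma$ and $\Delta,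 B \vdash \Gamma$ infer $\Delta, A \Rightarrow B \vdash \Gamma$); $\Rightarrow$R$^-$ (from $A \vdash B, \Gamma$ infer $\vdash A \Rightarrow B, \Gamma$). LLK$^-$ is the two-sided sequent calculus for LL$^-$ (propositional linear logic with $\top, \bot, 1, 0, \otimes, ⅋, \&, \oplus, \multimap, !, ?$ but without linear negation; here $\top$ is the unit of $\otimes$ and $\bot$ that of $⅋$) with rules: Id; Cut$^-$ (from $\Delta \vdash B$ and $\Delta', B \vdash \Gamma'$ infer $\Delta, \Delta' \vdash \Gamma'$); XL, XR; $!$W, $?$W (weakening on $!A$ on the left, $?B$ on the right); $!$C, $?$C (contraction); $!$D (from $\Delta, A \vdash \Gamma$ infer $\Delta, !A \vdash \Gamma$), $?$D (from $\Delta \vdash B, \Gamma$ infer $\Delta \vdash ?B, \Gamma$); $?$L (from $!\Delta, A \vdash ?\Gamma$ infer $!\Delta, ?A \vdash ?\Gamma$); $!$R (from $!\Delta \vdash B, ?\Gamma$ infer $!\Delta \vdash !B, ?\Gamma$); $0$L ($0 \vdash \Gamma$); $1$R ($\Delta \vdash 1, \Gamma$); $\top$L, $\top$R ($\vdash \top$), $\bot$L ($\bot \vdash$), $\bot$R; $\otimes$L (from $\Delta, A_1, A_2 \vdash \Gamma$ infer $\Delta, A_1 \otimes A_2 \vdash \Gamma$); $\otimes$R$^-$ (from $\Delta_1 \vdash B_1$ and $\Delta_2 \vdash B_2$ infer $\Delta_1, \Delta_2 \vdash B_1 \otimes B_2$); $\&$L (from $\Delta, A_i \vdash \Gamma$ infer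 $\Delta, A_1 \& A_2 \vdash \Gamma$); $\&$R$^-$ (from $\Delta \vdash B_1$ and $\Delta \vdash B_2$ infer $\Delta \vdash B_1 \& B_2$); $⅋$L$^-$ (from $A_1 \vdash \Gamma_1$ and $A_2 \vdash \Gamma_2$ infer $A_1 ⅋ A_2 \vdash \Gamma_1, \Gamma_2$); $⅋$R (from $\Delta \vdash B_1, B_2, \Gamma$ infer $\Delta \vdash B_1 ⅋ B_2, \Gamma$); $\oplus$L$^-$ (from $A_1 \vdash \Gamma$ and $A_2 \vdash \Gamma$ infer $A_1 \oplus A_2 \vdash \Gamma$); $\oplus$R (from $\Delta \vdash B_i, \Gamma$ infer $\Delta \vdash B_1 \oplus B_2, \Gamma$); $\multimap$L (from $\Delta_1 \vdash A, \Gamma_1$ and $\Delta_2, B \vdash \Gamma_2$ infer $\Delta_1, \Delta_2, A \multimap B \vdash \Gamma_1, \Gamma_2$); $\multimap$R$^-$ (from $A \vdash B, \Gamma$ infer $\vdash A \multimap B, \Gamma$); and the distribution rules: from $\Delta, ?!A \vdash \Gamma$ infer $\Delta, !?A \vdash \Gamma$; from $\Delta \vdash !?B, \Gamma$ infer $\Delta \vdash ?!B, \Gamma$; from $\Delta, (A \otimes B) ⅋ C \vdash \Gamma$ infer $\Delta, A, B ⅋ C \vdash \Gamma$; from $\Delta \vdash A \otimes (B ⅋ C), \Gamma$ infer $\Delta \vdash A \otimes B, C, \Gamma$. *)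

(* Defs.v *)
From Stdlib Require Import List.
Import ListNotations.

(** Negation is not primitive: [~ A] stands for [CImp A CBot]. *)
Inductive cformula (Atom : Type) : Type :=
| CVar (X : Atom)
| CTop
| CBot
| CAnd (A B : cformula Atom)
| COr (A B : cformula Atom)
| CImp (A B : cformula Atom).

Arguments CVar {Atom} X.
Arguments CTop {Atom}.
Arguments CBot {Atom}.
Arguments CAnd {Atom} A B.
Arguments COr {Atom} A B.
Arguments CImp {Atom} A B.

(** The convention on units: [LTop] is the unit of [LTensor], [LBot] that of
    [LPar], [LOne] that of [LWith] and [LZero] that of [LPlus] (so [LTop] and
    [LOne] are swapped with respect to Girard's notation). *)
Inductive lformula (Atom : Type) : Type :=
| LVar (X : Atom)
| LTop
| LBot
| LOne
| LZero
| LTensor (A B : lformula Atom)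
| LPar (A B : lformula Atom)
| LWith (A B : lformula Atom)
| LPlus (A B : lformula Atom)
| LLolli (A B : lformula Atom)
| LOfc (A : lformula Atom)
| LWhy (A : lformula Atom).

Arguments LVar {Atom} X.
Arguments LTop {Atom}.
Arguments LBot {Atom}.
Arguments LOne {Atom}.
Arguments LZero {Atom}.
Arguments LTensor {Atom} A B.
Arguments LPar {Atom} A B.
Arguments LWith {Atom} A B.
Arguments LPlus {Atom} A B.
Arguments LLolli {Atom} A B.
Arguments LOfc {Atom} A.
Arguments LWhy {Atom} A.

(** Sequents are pairs of lists, with explicit exchange.  As on paper, the
    principal formula is the last one on the left ([D ++ [A]]) and the first
    one on the right ([B :: G]).  [LKm D G] is the type of proofs of the
    sequent [D |- G] in LK^-. *)
Inductive LKm {Atom : Type} :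
  list (cformula Atom) -> list (cformula Atom) -> Type :=
| LK_Id A : LKm [A] [A]
| LK_Cut D D' G G' B :
    LKm D (B :: G) -> LKm (D' ++ [B]) G' -> LKm (D ++ D') (G ++ G')
| LK_XL D D' A A' G :
    LKm (D ++ A :: A' :: D') G -> LKm (D ++ A' :: A :: D') G
| LK_XR D B B' G G' :
    LKm D (G ++ B :: B' :: G') -> LKm D (G ++ B' :: B :: G')
| LK_WL D A G : LKm D G -> LKm (D ++ [A]) G
| LK_WR D B G : LKm D G -> LKm D (B :: G)
| LK_CL D A G : LKm (D ++ [A; A]) G -> LKm (D ++ [A]) G
| LK_CR D B G : LKm D (B :: B :: G) -> LKm D (B :: G)
| LK_TopL D G : LKm D G -> LKm (D ++ [CTop]) G
| LK_TopR : LKm [] [CTop]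
| LK_BotL : LKm [CBot] []
| LK_BotR D G : LKm D G -> LKm D (CBot :: G)
| LK_AndL D A1 A2 G : LKm (D ++ [A1; A2]) G -> LKm (D ++ [CAnd A1 A2]) G
| LK_AndR D B1 B2 G :
    LKm D (B1 :: G) -> LKm D (B2 :: G) -> LKm D (CAnd B1 B2 :: G)
| LK_OrL D A1 A2 G :
    LKm (D ++ [A1]) G -> LKm (D ++ [A2]) G -> LKm (D ++ [COr A1 A2]) G
| LK_OrR D B1 B2 G : LKm D (B1 :: B2 :: G) -> LKm D (COr B1 B2 :: G)
| LK_ImpL D A B G :
    LKm D (A :: G) -> LKm (D ++ [B]) G -> LKm (D ++ [CImp A B]) G
| LK_ImpR A B G : LKm [A] (B :: G) -> LKm [] (CImp A B :: G).

(** [LLKm D G] is the type of proofs of [D |- G] in LLK^-. *)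
Inductive LLKm {Atom : Type} :
  list (lformula Atom) -> list (lformula Atom) -> Type :=
| LLK_Id A : LLKm [A] [A]
| LLK_Cut D D' G' B :
    LLKm D [B] -> LLKm (D' ++ [B]) G' -> LLKm (D ++ D') G'
| LLK_XL D D' A A' G :
    LLKm (D ++ A :: A' :: D') G -> LLKm (D ++ A' :: A :: D') G
| LLK_XR D B B' G G' :
    LLKm D (G ++ B :: B' :: G') -> LLKm D (G ++ B' :: B :: G')
| LLK_OfcW D A G : LLKm D G -> LLKm (D ++ [LOfc A]) G
| LLK_WhyW D B G : LLKm D G -> LLKm D (LWhy B :: G)
| LLK_OfcC D A G : LLKm (D ++ [LOfc A; LOfc A]) G -> LLKm (D ++ [LOfc A]) G
| LLK_WhyC D B G : LLKm D (LWhy B :: LWhy B :: G) -> LLKm D (LWhy B :: G)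
| LLK_OfcD D A G : LLKm (D ++ [A]) G -> LLKm (D ++ [LOfc A]) G
| LLK_WhyD D B G : LLKm D (B :: G) -> LLKm D (LWhy B :: G)
| LLK_WhyL D A G :
    LLKm (map LOfc D ++ [A]) (map LWhy G) ->
    LLKm (map LOfc D ++ [LWhy A]) (map LWhy G)
| LLK_OfcR D B G :
    LLKm (map LOfc D) (B :: map LWhy G) ->
    LLKm (map LOfc D) (LOfc B :: map LWhy G)
| LLK_ZeroL G : LLKm [LZero] G
| LLK_OneR D G : LLKm D (LOne :: G)
| LLK_TopL D G : LLKm D G -> LLKm (D ++ [LTop]) G
| LLK_TopR : LLKm [] [LTop]
| LLK_BotL : LLKm [LBot] []
| LLK_BotR D G : LLKm D G -> LLKm D (LBot :: G)
| LLK_TensorL D A1 A2 G :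
    LLKm (D ++ [A1; A2]) G -> LLKm (D ++ [LTensor A1 A2]) G
| LLK_TensorR D1 D2 B1 B2 :
    LLKm D1 [B1] -> LLKm D2 [B2] -> LLKm (D1 ++ D2) [LTensor B1 B2]
| LLK_WithL1 D A1 A2 G : LLKm (D ++ [A1]) G -> LLKm (D ++ [LWith A1 A2]) G
| LLK_WithL2 D A1 A2 G : LLKm (D ++ [A2]) G -> LLKm (D ++ [LWith A1 A2]) G
| LLK_WithR D B1 B2 : LLKm D [B1] -> LLKm D [B2] -> LLKm D [LWith B1 B2]
| LLK_ParL A1 A2 G1 G2 :
    LLKm [A1] G1 -> LLKm [A2] G2 -> LLKm [LPar A1 A2] (G1 ++ G2)
| LLK_ParR D B1 B2 G : LLKm D (B1 :: B2 :: G) -> LLKm D (LPar B1 B2 :: G)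
| LLK_PlusL A1 A2 G : LLKm [A1] G -> LLKm [A2] G -> LLKm [LPlus A1 A2] G
| LLK_PlusR1 D B1 B2 G : LLKm D (B1 :: G) -> LLKm D (LPlus B1 B2 :: G)
| LLK_PlusR2 D B1 B2 G : LLKm D (B2 :: G) -> LLKm D (LPlus B1 B2 :: G)
| LLK_LolliL D1 D2 A B G1 G2 :
    LLKm D1 (A :: G1) -> LLKm (D2 ++ [B]) G2 ->
    LLKm (D1 ++ D2 ++ [LLolli A B]) (G1 ++ G2)
| LLK_LolliR A B G : LLKm [A] (B :: G) -> LLKm [] (LLolli A B :: G)
| LLK_OfcWhyL D A G :
    LLKm (D ++ [LWhy (LOfc A)]) G -> LLKm (D ++ [LOfc (LWhy A)]) G
| LLK_WhyOfcR D B G :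
    LLKm D (LOfc (LWhy B) :: G) -> LLKm D (LWhy (LOfc B) :: G)
| LLK_TensorParL D A B C G :
    LLKm (D ++ [LPar (LTensor A B) C]) G -> LLKm (D ++ [A; LPar B C]) G
| LLK_TensorParR D A B C G :
    LLKm D (LTensor A (LPar B C) :: G) -> LLKm D (LTensor A B :: C :: G).

(* Main.v *)
Require Import Defs.
From Stdlib Require Import List.
Import ListNotations.

(** Full classical cut is derivable in LLK^-: fold the side formulas [G] of the
    left premise into a single par [C] and the context [D'] of the right premise
    into a single tensor [A]; the linear distribution [A, B par C |- (A tensor B) par C]
    then turns the cut on [B] into single-conclusion cuts.

    Moreover [!?A] and [?!A] are linked by the rules [!R], [?L] and the
    distribution of [!] over [?], so a conclusion [?A] may be replaced by [!?A]
    or [?!A], and a hypothesis [!A] by [?!A] or [!?A].  Each rule of LK^- follows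
    by cutting these modified premises against a small derivation for the
    connective, and contracting the duplicated contexts. *)

Section LinearLogic.

Context {Atom : Type}.
Notation formula := (lformula Atom).

(** * Exchange and contraction of whole blocks of formulas *)

Lemma exchange_left_one (D1 D2 D3 : list formula) A G :
  LLKm (D1 ++ A :: D2 ++ D3) G -> LLKm (D1 ++ D2 ++ A :: D3) G.
Proof.
  revert D1; induction D2 as [|B D2 IH]; simpl; intros D1 p; [exact p|].
  apply LLK_XL in p.
  replace (D1 ++ B :: D2 ++ A :: D3) with ((D1 ++ [B]) ++ D2 ++ A :: D3)
    by (rewrite <- app_assoc; reflexivity).
  apply IH; rewrite <- app_assoc; exact p.
Qed.

Lemma exchange_right_one (D G1 G2 G3 : list formula) B :
  LLKm D (G1 ++ B :: G2 ++ G3) -> LLKm D (G1 ++ G2 ++ B :: G3).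
Proof.
  revert G1; induction G2 as [|C G2 IH]; simpl; intros G1 p; [exact p|].
  apply LLK_XR in p.
  replace (G1 ++ C :: G2 ++ B :: G3) with ((G1 ++ [C]) ++ G2 ++ B :: G3)
    by (rewrite <- app_assoc; reflexivity).
  apply IH; rewrite <- app_assoc; exact p.
Qed.

Lemma exchange_left (D1 D2 D3 D4 G : list formula) :
  LLKm (D1 ++ D2 ++ D3 ++ D4) G -> LLKm (D1 ++ D3 ++ D2 ++ D4) G.
Proof.
  revert D1; induction D2 as [|A D2 IH]; intros D1 p; [exact p|].
  apply exchange_left_one.
  change (LLKm (D1 ++ [A] ++ D3 ++ D2 ++ D4) G).
  rewrite app_assoc; apply IH; rewrite <- app_assoc; exact p.
Qed.

Lemma exchange_right (D G1 G2 G3 G4 : list formula) :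
  LLKm D (G1 ++ G2 ++ G3 ++ G4) -> LLKm D (G1 ++ G3 ++ G2 ++ G4).
Proof.
  revert G1; induction G2 as [|B G2 IH]; intros G1 p; [exact p|].
  apply exchange_right_one.
  change (LLKm D (G1 ++ [B] ++ G3 ++ G2 ++ G4)).
  rewrite app_assoc; apply IH; rewrite <- app_assoc; exact p.
Qed.

Lemma rotate_left (D1 D2 G : list formula) :
  LLKm (D1 ++ D2) G -> LLKm (D2 ++ D1) G.
Proof.
  intros p; rewrite <- (app_nil_r D1); apply (exchange_left [] D1 D2 []).
  rewrite app_nil_r; exact p.
Qed.

Lemma rotate_right (D G1 G2 : list formula) :
  LLKm D (G1 ++ G2) -> LLKm D (G2 ++ G1).
Proof.
  intros p; rewrite <- (app_nil_r G1); apply (exchange_right D [] G1 G2 []).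
  rewrite app_nil_r; exact p.
Qed.

(** The prefix [E] makes the induction go through: once the head formula is contracted it joins [E].
    In [contraction_right] the suffix [H] plays this part. *)
Lemma contraction_left (E D G : list formula) :
  LLKm (E ++ map LOfc D ++ map LOfc D) G -> LLKm (E ++ map LOfc D) G.
Proof.
  revert E; induction D as [|A D IH]; simpl; intros E p; [exact p|].
  assert (q : LLKm ((E ++ map LOfc D ++ map LOfc D) ++ [LOfc A; LOfc A]) G).
  { replace (E ++ LOfc A :: map LOfc D ++ LOfc A :: map LOfc D)
      with ((E ++ [LOfc A]) ++ map LOfc D ++ [LOfc A] ++ map LOfc D) in p
      by (rewrite <- app_assoc; reflexivity).
    apply exchange_left in p.
    rewrite <- app_assoc; apply (exchange_left E [LOfc A; LOfc A] _ []).
    rewrite app_nil_r; rewrite <- app_assoc in p; exact p. }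
  apply LLK_OfcC in q.
  change (LLKm (E ++ [LOfc A] ++ map LOfc D) G).
  rewrite app_assoc; apply IH; rewrite <- app_assoc.
  rewrite <- app_assoc in q.
  rewrite <- (app_nil_r (map LOfc D ++ map LOfc D)).
  apply exchange_left; rewrite app_nil_r; exact q.
Qed.

Lemma contraction_right (D G H : list formula) :
  LLKm D (map LWhy G ++ map LWhy G ++ H) -> LLKm D (map LWhy G ++ H).
Proof.
  revert H; induction G as [|B G IH]; simpl; intros H p; [exact p|].
  apply (exchange_right D [LWhy B] (map LWhy G) [LWhy B]) in p; simpl in p.
  apply LLK_WhyC in p.
  apply (rotate_right D [LWhy B]) in p.
  rewrite <- !app_assoc in p; apply IH in p.
  rewrite app_assoc in p; apply rotate_right in p; exact p.
Qed.

(** * Contexts folded into one formula, and classical cut *)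

Definition big_tensor : list formula -> formula := fold_right LTensor LTop.

Definition big_par : list formula -> formula := fold_right LPar LBot.

Lemma big_tensor_right D : LLKm D [big_tensor D].
Proof.
  induction D as [|A D IH]; simpl; [apply LLK_TopR|].
  apply (LLK_TensorR [A] D); [apply LLK_Id | exact IH].
Qed.

Lemma big_tensor_left E D G :
  LLKm (E ++ D) G -> LLKm (E ++ [big_tensor D]) G.
Proof.
  revert E; induction D as [|A D IH]; simpl; intros E p.
  - apply LLK_TopL; rewrite app_nil_r in p; exact p.
  - apply LLK_TensorL.
    change (LLKm (E ++ [A] ++ [big_tensor D]) G).
    rewrite app_assoc; apply IH; rewrite <- app_assoc; exact p.
Qed.

Lemma big_par_left G : LLKm [big_par G] G.
Proof.
  induction G as [|B G IH]; simpl; [apply LLK_BotL|].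
  apply (LLK_ParL B (big_par G) [B] G); [apply LLK_Id | exact IH].
Qed.

Lemma big_par_right D G H :
  LLKm D (G ++ H) -> LLKm D (big_par G :: H).
Proof.
  revert H; induction G as [|B G IH]; simpl; intros H p.
  - apply LLK_BotR; exact p.
  - apply LLK_ParR.
    apply (rotate_right D [B]) in p; rewrite <- app_assoc in p.
    apply IH in p; exact (rotate_right D (big_par G :: H) [B] p).
Qed.

Lemma classical_cut (D D' G G' : list formula) B :
  LLKm D (B :: G) -> LLKm (D' ++ [B]) G' -> LLKm (D ++ D') (G ++ G').
Proof.
  intros p q.
  assert (p' : LLKm D [LPar B (big_par G)]).
  { apply LLK_ParR.
    apply (rotate_right D [B] G), big_par_right in p.
    exact (rotate_right D [big_par G] [B] p). }
  assert (q' : LLKm [LTensor (big_tensor D') B] G').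
  { apply (LLK_TensorL []), (rotate_left [B] [big_tensor D']).
    apply (big_tensor_left [B]), rotate_left; exact q. }
  (* [LLK_ParL] admits no hypothesis beside the par, so [D'] has to enter through the single tensor
     that [LLK_TensorParL] attaches to [B]. *)
  assert (r : LLKm [big_tensor D'; LPar B (big_par G)] (G' ++ G)).
  { apply (LLK_TensorParL []), (LLK_ParL _ _ G' G);
      [exact q' | apply big_par_left]. }
  apply rotate_right, rotate_left.
  apply (LLK_Cut D' D _ (big_tensor D')); [apply big_tensor_right|].
  exact (LLK_Cut D [big_tensor D'] _ _ p' r).
Qed.

(** * Changes of modality *)

Lemma why_ofc_left (D G : list formula) (A : formula) :
  LLKm (map LOfc D ++ [LOfc A]) (map LWhy G) ->
  LLKm (map LOfc D ++ [LWhy (LOfc A)]) (map LWhy G).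
Proof. apply LLK_WhyL. Qed.

Lemma ofc_why_left (D G : list formula) (A : formula) :
  LLKm (map LOfc D ++ [LOfc A]) (map LWhy G) ->
  LLKm (map LOfc D ++ [LOfc (LWhy A)]) (map LWhy G).
Proof. intros p; apply LLK_OfcWhyL, LLK_WhyL, p. Qed.

Lemma why_ofc_right (D G : list formula) (B : formula) :
  LLKm (map LOfc D) (LWhy B :: map LWhy G) ->
  LLKm (map LOfc D) (LWhy (LOfc B) :: map LWhy G).
Proof. intros p; apply LLK_WhyOfcR, LLK_OfcR, p. Qed.

(** * Derived rules for the translated connectives *)

(** Each projection of [W] promotes to a proof of [!?A] or [!?B] from [!W]. Cutting both leaves two
    copies of [!W], which contract. *)
Lemma ofc_with_left (D G : list formula) (A B : formula) :
  LLKm (map LOfc D ++ [LOfc A; LOfc B]) (map LWhy G) ->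
  LLKm (map LOfc D ++ [LOfc (LWith (LWhy A) (LWhy B))]) (map LWhy G).
Proof.
  intros p.
  set (W := LWith (LWhy A) (LWhy B)).
  assert (pA : LLKm [LOfc W] [LOfc (LWhy A)]).
  { apply (LLK_OfcR [W] (LWhy A) []), (LLK_OfcD []), (LLK_WithL1 []), LLK_Id. }
  assert (pB : LLKm [LOfc W] [LOfc (LWhy B)]).
  { apply (LLK_OfcR [W] (LWhy B) []), (LLK_OfcD []), (LLK_WithL2 []), LLK_Id. }
  assert (q : LLKm (map LOfc (D ++ [A]) ++ [LOfc (LWhy B)]) (map LWhy G)).
  { apply ofc_why_left; rewrite map_app, <- app_assoc; exact p. }
  apply (LLK_Cut _ _ _ _ pB), rotate_left in q.
  assert (r : LLKm (map LOfc (D ++ [W]) ++ [LOfc (LWhy A)]) (map LWhy G)).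
  { apply ofc_why_left.
    rewrite map_app, <- app_assoc in q |- *.
    exact (exchange_left _ [LOfc A] [LOfc W] [] _ q). }
  apply (LLK_Cut _ _ _ _ pA), rotate_left in r.
  rewrite map_app, <- app_assoc in r.
  apply LLK_OfcC, r.
Qed.

(** [LLK_WithR] allows no side conclusions, so it is applied only to [!?A, !?B], each branch
    weakening away the other hypothesis. Classical cuts then bring the side contexts back. *)
Lemma why_with_right (D G : list formula) (A B : formula) :
  LLKm (map LOfc D) (LWhy A :: map LWhy G) ->
  LLKm (map LOfc D) (LWhy B :: map LWhy G) ->
  LLKm (map LOfc D) (LWhy (LWith (LWhy A) (LWhy B)) :: map LWhy G).
Proof.
  intros pA pB.
  apply LLK_OfcR in pA, pB.
  assert (r : LLKm ([LOfc (LWhy A)] ++ [LOfc (LWhy B)])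
                [LWhy (LWith (LWhy A) (LWhy B))]).
  { apply LLK_WhyD, LLK_WithR.
    - apply (LLK_OfcW [_]), (LLK_OfcD []), LLK_Id.
    - apply (rotate_left [_] [_]), (LLK_OfcW [_]), (LLK_OfcD []), LLK_Id. }
  apply (classical_cut _ _ _ _ _ pB), rotate_left in r.
  apply (rotate_left [_]), (classical_cut _ _ _ _ _ pA) in r.
  apply (contraction_left []) in r.
  apply contraction_right in r.
  apply rotate_right in r; exact r.
Qed.

(** Dual situation: [LLK_PlusL] allows no side hypotheses, so the plus is first split into the two
    conclusions [?!A, ?!B], which are then cut. *)
Lemma ofc_plus_left (D G : list formula) (A B : formula) :
  LLKm (map LOfc D ++ [LOfc A]) (map LWhy G) ->
  LLKm (map LOfc D ++ [LOfc B]) (map LWhy G) ->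
  LLKm (map LOfc D ++ [LOfc (LPlus (LOfc A) (LOfc B))]) (map LWhy G).
Proof.
  intros pA pB.
  apply why_ofc_left in pA, pB.
  assert (r : LLKm [LOfc (LPlus (LOfc A) (LOfc B))]
                ([LWhy (LOfc A)] ++ [LWhy (LOfc B)])).
  { apply (LLK_OfcD []), LLK_PlusL.
    - apply (rotate_right _ [_] [_]), LLK_WhyW, LLK_WhyD, LLK_Id.
    - apply LLK_WhyW, LLK_WhyD, LLK_Id. }
  pose proof (classical_cut _ _ _ _ _ r pA) as s.
  pose proof (classical_cut _ _ _ _ _ s pB) as t.
  rewrite <- app_assoc in t.
  apply contraction_left, rotate_left in t.
  rewrite <- (app_nil_r (map LWhy G ++ _)), <- app_assoc in t.
  apply contraction_right in t.
  rewrite app_nil_r in t; exact t.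
Qed.

Lemma why_plus_right (D G : list formula) (A B : formula) :
  LLKm (map LOfc D) (LWhy A :: LWhy B :: map LWhy G) ->
  LLKm (map LOfc D) (LWhy (LPlus (LOfc A) (LOfc B)) :: map LWhy G).
Proof.
  intros p.
  set (P := LPlus (LOfc A) (LOfc B)).
  assert (pA : LLKm [LWhy (LOfc A)] [LWhy P]).
  { apply (LLK_WhyL [] _ [_]), LLK_WhyD, LLK_PlusR1, LLK_Id. }
  assert (pB : LLKm [LWhy (LOfc B)] [LWhy P]).
  { apply (LLK_WhyL [] _ [_]), LLK_WhyD, LLK_PlusR2, LLK_Id. }
  apply (why_ofc_right D (B :: G) A) in p.
  apply (fun p => classical_cut _ [] _ _ _ p pA) in p.
  rewrite app_nil_r in p.
  (* The new conclusion [LWhy P] joins the side context, which keeps the form [map LWhy] that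
     promotion requires. *)
  assert (q : LLKm (map LOfc D) (LWhy B :: map LWhy (G ++ [P]))).
  { rewrite map_app; exact p. }
  apply why_ofc_right in q.
  apply (fun p => classical_cut _ [] _ _ _ p pB) in q.
  rewrite app_nil_r, map_app, <- app_assoc in q.
  apply rotate_right in q.
  apply LLK_WhyC, q.
Qed.

(** Promotion and [LLK_WhyL] yield exactly the premises of [LLK_LolliL]. That rule concatenates
    contexts, hence the contractions. *)
Lemma ofc_lolli_left (D G : list formula) (A B : formula) :
  LLKm (map LOfc D) (LWhy A :: map LWhy G) ->
  LLKm (map LOfc D ++ [LOfc B]) (map LWhy G) ->
  LLKm (map LOfc D ++ [LOfc (LLolli (LOfc (LWhy A)) (LWhy (LOfc B)))])
    (map LWhy G).
Proof.
  intros pA pB.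
  apply LLK_OfcR in pA; apply why_ofc_left in pB.
  pose proof (LLK_LolliL _ _ _ _ _ _ pA pB) as r.
  rewrite app_assoc in r; apply LLK_OfcD, rotate_left, contraction_left in r.
  rewrite <- (app_nil_r (map LWhy G ++ _)), <- app_assoc in r.
  apply contraction_right in r.
  rewrite app_nil_r in r; exact (rotate_left [_] _ _ r).
Qed.

Lemma why_lolli_right (G : list formula) (A B : formula) :
  LLKm [LOfc A] (LWhy B :: map LWhy G) ->
  LLKm [] (LWhy (LLolli (LOfc (LWhy A)) (LWhy (LOfc B))) :: map LWhy G).
Proof.
  intros p; apply LLK_WhyD, LLK_LolliR.
  (* The conclusion [?!B] still begins with [?], so [LLK_WhyL] remains applicable on the left. *)
  apply (ofc_why_left [] (LOfc B :: G) A), (why_ofc_right [A] G B), p.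
Qed.

(** * Translation of formulas and proofs *)

Fixpoint translate (A : cformula Atom) : formula :=
  match A with
  | CVar X => LVar X
  | CTop => LTop
  | CBot => LBot
  | CAnd A B => LWith (LWhy (translate A)) (LWhy (translate B))
  | COr A B => LPlus (LOfc (translate A)) (LOfc (translate B))
  | CImp A B => LLolli (LOfc (LWhy (translate A))) (LWhy (LOfc (translate B)))
  end.

Lemma translate_proof D G :
  LKm D G -> LLKm (map LOfc (map translate D)) (map LWhy (map translate G)).
Proof.
  induction 1; rewrite ?map_app in *; simpl in *.
  - apply LLK_WhyD, (LLK_OfcD []), LLK_Id.
  (* The cut formula occurs as [?B] in one premise and [!B] in the other; both become [?!B]. *)
  - eapply classical_cut; [apply why_ofc_right | apply why_ofc_left]; eassumption.
  - apply LLK_XL; assumption.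
  - apply LLK_XR; assumption.
  - apply LLK_OfcW; assumption.
  - apply LLK_WhyW; assumption.
  - apply LLK_OfcC; assumption.
  - apply LLK_WhyC; assumption.
  (* The unit arrives as [!LTop], so its left rule is an instance of weakening; likewise [?LBot] on
     the right below. *)
  - apply LLK_OfcW; assumption.
  - apply LLK_WhyD, LLK_TopR.
  - apply (LLK_OfcD []), LLK_BotL.
  - apply LLK_WhyW; assumption.
  - apply ofc_with_left; assumption.
  - apply why_with_right; assumption.
  - apply ofc_plus_left; assumption.
  - apply why_plus_right; assumption.
  - apply ofc_lolli_left; assumption.
  - apply why_lolli_right; assumption.
Qed.

End LinearLogic.

Theorem mainTheorem1 : forall Atom : Type,
  exists (Tc : cformula Atom -> lformula Atom)
         (Tp : forall D G : list (cformula Atom),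
            LKm D G -> LLKm (map LOfc (map Tc D)) (map LWhy (map Tc G))),
    (forall X : Atom, Tc (CVar X) = LVar X) /\
    Tc CTop = LTop /\
    Tc CBot = LBot /\
    (forall A B : cformula Atom,
        Tc (CAnd A B) = LWith (LWhy (Tc A)) (LWhy (Tc B))) /\
    (forall A B : cformula Atom,
        Tc (COr A B) = LPlus (LOfc (Tc A)) (LOfc (Tc B))) /\
    (forall A B : cformula Atom,
        Tc (CImp A B) = LLolli (LOfc (LWhy (Tc A))) (LWhy (LOfc (Tc B)))).
Proof.
  intros Atom; exists translate, translate_proof; repeat split; reflexivity.
Qed.
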